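(* Let $U:\mathbb{R}^{n}\to\mathbb{R}$ be a nonnegative $C^{2}$ function which is quasi-homogeneous with vector $\boldsymbol{\alpha}=(\alpha_1,\ldots,\alpha_n)\in\mathbb{R}^{n}$, i.e. there is $r\in\mathbb{R}$ such that $$U(\lambda^{\alpha_1}x_1,\ldots,\lambda^{\alpha_n}x_n)=\lambda^{r}\,U(x_1,\ldots,x_n)\qquad\text{for all }\lambda>0,\ (x_1,\ldots,x_n)\in\mathbb{R}^{n}.$$ Let $V_{\boldsymbol{\alpha}}$ be the set of points $\mathbf{x}\in\mathbb{R}^{n}$ such that $\alpha_i x_i\neq 0$ for some index $i$. Then every point of $(U^{-1}(0)\cap V_{\boldsymbol{\alpha}})\times\{\mathbf{0}\}$ is a Lyapunov unstable equilibrium point of the Newtonian dynamics $\ddot{\mathbf{x}}=-\nabla U(\mathbf{x})$.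
   Context: The Newtonian dynamics is the Euler-Lagrange dynamics on $T\mathbb{R}^{n}=\mathbb{R}^{n}\times\mathbb{R}^{n}$ of $L(x,v)=\Vert v\Vert^{2}/2-U(x)$ with the Euclidean norm. An equilibrium point $(p,\mathbf{0})$ is Lyapunov stable if for every neighborhood $\mathcal{O}$ of it in $\mathbb{R}^{n}\times\mathbb{R}^{n}$ there is a neighborhood $\mathcal{O}'$ of it such that every solution $(x(t),\dot x(t))$ with $(x(0),\dot x(0))\in\mathcal{O}'$ is defined and stays in $\mathcal{O}$ for all $t\ge 0$; it is Lyapunov unstable if it is not Lyapunov stable. *)

(* Defs.v *)
From HB Require Import structures.
From mathcomp Require Import all_boot all_order all_algebra.
From mathcomp Require Import all_classical all_reals all_analysis.

Set Implicit Arguments.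
Unset Strict Implicit.
Unset Printing Implicit Defensive.

Import Order.TTheory GRing.Theory Num.Theory.
Import numFieldNormedType.Exports.

Local Open Scope classical_set_scope.
Local Open Scope ring_scope.

(* R^n is 'rV[R]_n. Its library norm is the sup norm; only the topology and
   the partial derivatives are used below, and neither depends on the choice
   of norm. *)

Definition partial (R : realType) (n : nat) (i : 'I_n)
    (f : 'rV[R]_n -> R) (x : 'rV[R]_n) : R :=
  'D_('e_i) f x.

Fixpoint is_Ck (R : realType) (n k : nat) (f : 'rV[R]_n -> R) : Prop :=
  continuous f /\
  if k is k'.+1 then
    forall i : 'I_n, (forall x, derivable f x 'e_i) /\ is_Ck k' (partial i f)
  else True.

(* Gradient for the Euclidean inner product. *)
Definition grad (R : realType) (n : nat) (U : 'rV[R]_n -> R)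
    (x : 'rV[R]_n) : 'rV[R]_n :=
  \row_i partial i U x.

Definition quasi_homogeneous (R : realType) (n : nat) (alpha : 'rV[R]_n)
    (U : 'rV[R]_n -> R) : Prop :=
  exists r : R, forall lambda : R, 0 < lambda -> forall x : 'rV[R]_n,
    U (\row_i (lambda `^ alpha 0 i * x 0 i)) = lambda `^ r * U x.

Definition V_ (R : realType) (n : nat) (alpha : 'rV[R]_n) : set 'rV[R]_n :=
  [set x | exists i : 'I_n, alpha 0 i * x 0 i != 0].

(* A solution on J is a total function of which only the values on J matter:
   since J is open, so do the derivatives at points of J. *)
Definition newton_solution (R : realType) (n : nat) (U : 'rV[R]_n -> R)
    (J : set R) (x : R -> 'rV[R]_n) : Prop :=
  [/\ open J, is_interval J, J 0 &
      forall t, J t -> derivable x t 1 /\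
                       is_derive t (1 : R) (derive1 x) (- grad U (x t))].

(* Not the restriction of a solution on a strictly larger interval. *)
Definition maximal_newton_solution (R : realType) (n : nat)
    (U : 'rV[R]_n -> R) (J : set R) (x : R -> 'rV[R]_n) : Prop :=
  newton_solution U J x /\
  forall (J' : set R) (y : R -> 'rV[R]_n), newton_solution U J' y ->
    J `<=` J' -> (forall t, J t -> y t = x t) -> J' = J.

Definition phase (R : realType) (n : nat) (x : R -> 'rV[R]_n) (t : R)
    : 'rV[R]_n * 'rV[R]_n :=
  (x t, derive1 x t).

Definition equilibrium (R : realType) (n : nat) (U : 'rV[R]_n -> R)
    (z : 'rV[R]_n * 'rV[R]_n) : Prop :=
  exists2 x, newton_solution U setT x & forall t, phase x t = z.

(* Solutions are taken with their maximal interval of existence, so that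
   "defined for all t >= 0" is the condition J t. *)
Definition lyapunov_stable (R : realType) (n : nat) (U : 'rV[R]_n -> R)
    (z : 'rV[R]_n * 'rV[R]_n) : Prop :=
  forall O, nbhs z O -> exists2 O', nbhs z O' &
    forall J x, maximal_newton_solution U J x -> O' (phase x 0) ->
      forall t, 0 <= t -> J t /\ O (phase x t).

Definition lyapunov_unstable (R : realType) (n : nat) (U : 'rV[R]_n -> R)
    (z : 'rV[R]_n * 'rV[R]_n) : Prop :=
  ~ lyapunov_stable U z.

(* Main.v *)
(** Let X be the Euler vector field, X_i(x) = alpha_i x_i, so that X U = r U.
    Along a solution, G = (1/2) \sum_i alpha_i x_i^2 satisfies G' = <X(x), x'>
    and G'' = \sum_i alpha_i x_i'^2 - r U(x), and since U >= 0 conservation of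
    energy gives |G''| <= C e^2 when the energy is of order e^2.  Start at a zero
    p of U with velocity e X(p).  Then G'(0) = e |X(p)|^2 > 0, so on a time
    interval of length |X(p)|^2 / (2 C e) the derivative G' stays above half its
    initial value and G increases by at least |X(p)|^4 / (4 C), an amount which
    does not depend on e.

    Stability quantifies over maximal solutions only, so such a solution has to
    be exhibited: Picard iteration gives a local one, and Zorn's lemma a maximal
    extension of it. *)

From HB Require Import structures.
Require Import Defs.
From mathcomp Require Import all_boot all_order all_algebra.
From mathcomp Require Import all_classical all_reals all_analysis.
From mathcomp Require Import ring lra.

Import Order.TTheory GRing.Theory Num.Theory.
Import numFieldNormedType.Exports.

Local Open Scope classical_set_scope.
Local Open Scope ring_scope.

Set Implicit Arguments.
Unset Strict Implicit.

(** * Calculus of C^1 functions *)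

(** The mean value theorem with endpoints in either order, so that negative times and negative
    coordinate increments are covered too. *)
Lemma MVT_bound (R : realType) (g dg : R -> R) (a b K : R) :
  (forall x, Num.min a b <= x <= Num.max a b -> is_derive x 1 g (dg x)) ->
  (forall x, Num.min a b <= x <= Num.max a b -> `|dg x| <= K) ->
  `|g b - g a| <= K * `|b - a|.
Proof.
wlog ab : a b / a <= b => [hw|].
  case: (leP a b) => [ab|/ltW ba].
    by have := hw a b ab; rewrite (min_l ab) (max_r ab).
  have := hw b a ba; rewrite (min_l ba) (max_r ba) (distrC (g b)) (distrC b); exact.
rewrite (min_l ab) (max_r ab) => dgP dgK.
have [x||x xab ->] := MVT_segment (f := g) (df := dg) ab.
- by rewrite in_itv/= => /andP[/ltW ax /ltW xb]; apply: dgP; rewrite ax.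
- apply: derivable_within_continuous => x; rewrite in_itv/= => xab.
  by case: (dgP x xab).
- by rewrite normrM ler_wpM2r// dgK//; move: xab; rewrite in_itv.
Qed.

Lemma ler_coord_norm (R : realType) m n (x : 'M[R]_(m, n)) i j : `|x i j| <= `|x|.
Proof.
rewrite [leRHS]/Num.Def.normr/= mx_normrE.
exact: (le_bigmax _ (fun ij => `|x ij.1 ij.2|) (i, j)).
Qed.

Lemma rV_norm_le (R : realType) n (x : 'rV[R]_n) (K : R) :
  0 <= K -> (forall i, `|x 0 i| <= K) -> `|x| <= K.
Proof.
move=> K0 xK; rewrite [leLHS]/Num.Def.normr/= mx_normrE.
by apply: bigmax_le => // -[i j] _ /=; rewrite ord1.
Qed.

Lemma is_derive_line (R : realType) (V W : normedModType R) (f : V -> W)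
    (z v : V) (s : R) :
  derivable f (z + s *: v) v ->
  is_derive s (1 : R) (fun s => f (z + s *: v)) ('D_v f (z + s *: v)).
Proof.
have E : (fun h : R => h^-1 *: 
      (((fun s => f (z + s *: v)) \o shift s) (h *: 1) - f (z + s *: v))) =
      (fun h : R => h^-1 *: ((f \o shift (z + s *: v)) (h *: v) - f (z + s *: v))).
  by apply/funext => h /=; rewrite [_%:A]mulr1 scalerDl addrCA.
by move=> df; split; rewrite /derivable /derive E.
Qed.

(** Serves two purposes: with [c] the gradient at [a] and [e] small it gives differentiability at
    [a]; with [c = 0] and [e] a bound on the partial derivatives it gives a Lipschitz estimate. The
    factor [n] counts the one-coordinate moves. *)
Lemma partial_increment (R : realType) n (f : 'rV[R]_n -> R) (c a : 'rV[R]_n)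
    (rho e : R) :
  0 <= e -> (forall i x, derivable f x 'e_i) ->
  (forall x, `|x - a| <= rho -> forall i, `|partial i f x - c 0 i| <= e) ->
  forall x y, `|x - a| <= rho -> `|y - a| <= rho ->
  `|f y - f x - \sum_i c 0 i * (y - x) 0 i| <= n%:R * e * `|y - x|.
Proof.
move=> e0 df fc x y xa ya.
have rho0 : 0 <= rho := le_trans (normr_ge0 _) xa.
(* Telescoping along the path that changes one coordinate at a time, which
   stays in the ball because balls of the sup norm are cubes. *)
pose z k : 'rV[R]_n := \row_i (if (i < k)%N then y 0 i else x 0 i).
have -> : f y = f (z n) by congr f; apply/rowP => i; rewrite !mxE ltn_ord.
have -> : f x = f (z 0%N) by congr f; apply/rowP => i; rewrite !mxE.
rewrite -(telescope_sumr (f \o z) (leq0n n)) big_mkord -sumrB.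
apply: le_trans (ler_norm_sum _ _ _) _.
rewrite -mulrA mulr_natl -[X in _ *+ X]card_ord -sumr_const.
apply: ler_sum => i _.
set d := (y - x) 0 i.
have zS : z i.+1 = z i + d *: 'e_i.
  apply/rowP => j; rewrite !mxE eqxx/= ltnS leq_eqVlt -val_eqE/=.
  case: (ltngtP (j : nat) i) => [ji|ji|/val_inj ->] /=; rewrite ?mulr0 ?addr0// mulr1.
  by rewrite /d !mxE addrC subrK.
have zin s : Num.min 0 d <= s <= Num.max 0 d -> `|z i + s *: 'e_i - a| <= rho.
  move=> sd; apply: rV_norm_le => // j; rewrite !mxE eqxx/= -val_eqE/=.
  have xj := le_trans (ler_coord_norm (x - a) 0 j) xa.
  have yj := le_trans (ler_coord_norm (y - a) 0 j) ya.
  rewrite !mxE in xj yj.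
  case: (ltngtP (j : nat) i) => [ji|ji|/val_inj ji] /=; rewrite ?mulr0 ?addr0// mulr1.
  move: sd xj yj; rewrite /d !mxE ji !ler_norml; case: (leP 0 (y 0 i - x 0 i)) => _; lra.
rewrite /= zS.
(* Subtracting the linear term leaves a function whose derivative is exactly the deviation bounded
   by [e]. *)
have := MVT_bound (g := fun s => f (z i + s *: 'e_i) - c 0 i * s)
  (dg := fun s => partial i f (z i + s *: 'e_i) - c 0 i) (a := 0) (b := d) (K := e).
rewrite scale0r addr0 mulr0 !subr0 addrAC => H.
apply: le_trans (H _ _) _.
- move=> s _; have := is_derive_line (df i (z i + s *: 'e_i)) => df1.
  by apply: is_derive_eq; rewrite scaler1.
- by move=> s /zin /fc.
- by rewrite ler_wpM2l// ler_coord_norm.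
Qed.

Lemma continuous_fsum (R : realType) (T : topologicalType) n (h : 'I_n -> T -> R) :
  (forall i, continuous (h i)) -> continuous (fun x => \sum_i h i x).
Proof.
move=> ch; have -> : (fun x => \sum_i h i x) = \sum_i h i.
  by apply/funext => x; rewrite fct_sumE.
elim/big_ind: _ => [x|f g cf cg x|i _ x]; first exact: (@cst_continuous _ _ 0).
  by apply: continuousD; [exact: cf|exact: cg].
exact: ch.
Qed.

Lemma linear_form_continuous (R : realType) n (c : 'I_n -> R) :
  continuous (fun h : 'rV[R]_n => \sum_i c i * h 0 i).
Proof.
apply: continuous_fsum => i h.
by apply: continuousM; [exact: cst_continuous|exact: coord_continuous].
Qed.

Lemma is_diff_of_norm_le (R : realFieldType) (V W : normedModType R) (f : V -> W)
    (df : {linear V -> W}) (x : V) :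
  continuous df ->
  (forall e : R, 0 < e ->
    \forall h \near (0 : V), `|f (h + x) - f x - df h| <= e * `|h|) ->
  is_diff x f df.
Proof.
move=> cdf fe.
have dE : f \o shift x = cst (f x) + df +o_ 0 id.
  apply/eqaddoP => _/posnumP[e]; near=> h.
  by rewrite !fctE /= opprD addrA; near: h; exact: fe.
have dfE := diff_unique cdf dE.
by split => //; apply/diff_locallyP; rewrite dfE.
Unshelve. all: by end_near. Qed.

Lemma is_CkS (R : realType) n k (f : 'rV[R]_n -> R) : is_Ck k.+1 f -> is_Ck k f.
Proof.
elim: k f => [|k IH] f [cf fC]; first by split.
by split=> // i; have [df pf] := fC i; split=> //; exact: IH.
Qed.

Lemma C1_is_diff (R : realType) n (f : 'rV[R]_n -> R) (x : 'rV[R]_n) :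
  is_Ck 1 f ->
  is_diff x f (fun h : 'rV[R]_n => \sum_i partial i f x * h 0 i).
Proof.
move=> [_ fC].
pose d (h : 'rV[R]_n) : R := \sum_i partial i f x * h 0 i.
have lin_d : linear d.
  move=> a u v; rewrite /d scaler_sumr -big_split; apply: eq_bigr => i _ /=.
  by rewrite !mxE mulrDr mulrCA.
pose dM := GRing.isLinear.Build _ _ _ _ _ lin_d.
pose dL : {linear _ -> _} := HB.pack d dM.
have cd : continuous dL by exact: linear_form_continuous.
suff : is_diff x f dL by exact.
apply: (@is_diff_of_norm_le _ _ _ f dL) => [//|e e0].
(* Absorbs the factor [n] of [partial_increment]; the successor avoids dividing by zero when
   [n = 0]. *)
pose e' := e / n.+1%:R.
have e'0 : 0 < e' by rewrite divr_gt0.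
have : \forall y \near x, forall i, `|partial i f y - partial i f x| <= e'.
  apply: (@filter_forall _ _ (fun i y => `|partial i f y - partial i f x| <= e')
    _ (nbhs_filter x)) => i.
  have [_ [ci _]] := fC i.
  by move/cvgrPdist_le: (ci x) => /(_ _ e'0); apply: filterS => y; rewrite distrC.
move=> /nbhs_normP[r /= r0 rP].
have inc := @partial_increment R n f (\row_i partial i f x) x (r / 2) e'
  (ltW e'0) (fun i => (fC i).1).
near=> h => /=.
have hr : `|h| <= r / 2.
  by near: h; refine (@nbhs0_le R 'rV[R]_n (r / 2) _); rewrite divr_gt0.
have := inc _ x (h + x); rewrite subrr normr0 addrK => /(_ _ _ hr) H.
have sE : \sum_i (\row_j partial j f x) 0 i * h 0 i = d h.
  by apply: eq_bigr => i _; rewrite mxE.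
rewrite -sE; apply: le_trans (H _ _) _.
- move=> y yx i; rewrite mxE; apply: rP; rewrite /= distrC.
  by apply: le_lt_trans yx _; lra.
- by rewrite divr_ge0// ltW.
- rewrite ler_wpM2r// /e' mulrCA ler_piMr//; first exact: ltW.
  by rewrite ler_pdivrMr// mul1r ler_nat.
Unshelve. all: by end_near. Qed.

Lemma C1_chain_rule (R : realType) n (f : 'rV[R]_n -> R) (c : R -> 'rV[R]_n) t :
  is_Ck 1 f -> derivable c t 1 ->
  is_derive t (1 : R) (f \o c) (\sum_i partial i f (c t) * derive1 c t 0 i).
Proof.
move=> fC dc; have df := C1_is_diff (c t) fC.
have dct : differentiable c t by apply/derivable1_diffP.
split; first by apply/derivable1_diffP/differentiable_comp.
rewrite deriveE; last exact: differentiable_comp.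
by rewrite diff_comp//= diff_val derive1E (deriveE _ dct).
Qed.

(** By continuity the partial derivatives stay bounded near [p]. The estimate is stated for all
    small radii so that finitely many functions can share one. *)
Lemma C1_locally_lipschitz (R : realType) n (f : 'rV[R]_n -> R) (p : 'rV[R]_n) :
  is_Ck 1 f ->
  exists2 L : R, 0 <= L & \forall r \near 0^'+, forall x y,
    `|x - p| <= r -> `|y - p| <= r -> `|f y - f x| <= L * `|y - x|.
Proof.
move=> [_ fC].
pose K := \sum_i `|partial i f p| + 1.
have K0 : 0 <= K by rewrite addr_ge0 ?sumr_ge0.
exists (n%:R * K); first by rewrite mulr_ge0.
have : \forall y \near p, forall i, `|partial i f y| <= K.
  apply: (@filter_forall _ _ (fun i y => `|partial i f y| <= K) _ (nbhs_filter p)) => i.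
  have [_ [ci _]] := fC i.
  move/cvgrPdist_le: (ci p) => /(_ _ ltr01); apply: filterS => y h.
  rewrite -(subrK (partial i f p) (partial i f y)).
  apply: le_trans (ler_normD _ _) _; rewrite addrC distrC lerD//.
  by rewrite (bigD1 i)//= lerDl sumr_ge0.
move=> /nbhs_normP[r0 /= r00 rP].
near=> r => x y xp yp.
have := @partial_increment R n f 0 p r K K0 (fun i => (fC i).1) _ x y xp yp.
rewrite [\sum_i _]big1 ?subr0; last by move=> i _; rewrite mxE mul0r.
apply => z zp i; rewrite mxE subr0; apply: rP => /=; rewrite distrC.
apply: le_lt_trans zp _; near: r; exact: nbhs_right_lt.
Unshelve. all: by end_near. Qed.

(** * Existence of solutions *)

Lemma primitive (R : realType) (f : R -> R) (b : R) : continuous f -> 0 < b ->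
  exists2 F : R -> R, F 0 = 0 & forall x, `|x| < b -> is_derive x (1 : R) F (f x).
Proof.
move=> cf b0; pose mu := @lebesgue_measure R.
pose G x := (\int[mu]_(t in [set` `[- b, x]]) f t)%R.
have dG x : `|x| < b -> is_derive x (1 : R) G (f x).
  rewrite ltr_norml => /andP[bx xb].
  have intf : mu.-integrable `[- b, b] (EFin \o f).
    apply: continuous_compact_integrable; first exact: segment_compact.
    exact: continuous_subspaceT.
  have [dG GE] := continuous_FTC1_closed xb intf bx (cf x).
  by split => //; rewrite -derive1E.
(* Integrating from [- b] puts 0 in the interior, where the fundamental theorem applies; subtracting
   [G 0] restores the value at 0. *)
exists (fun x => G x - G 0); first by rewrite subrr.
move=> x /dG dGx; have := is_deriveB dGx (is_derive_cst (G 0) x (1 : R)).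
by rewrite subr0.
Qed.

(** The retraction of the line onto [-h, h]: composing with it extends a function controlled only on
    that segment to all times. *)
Definition clamp (R : realType) (h x : R) : R := Num.max (- h) (Num.min x h).

Lemma clamp_continuous (R : realType) (h : R) : continuous (clamp h).
Proof.
move=> x; apply: (@continuous_max R _ (cst (- h)) (fun x => Num.min x h)).
  exact: cst_continuous.
apply: (@continuous_min R _ id (cst h)); [exact: id|exact: cst_continuous].
Qed.

Lemma clamp_norm_le (R : realType) (h x : R) : 0 <= h -> `|clamp h x| <= h.
Proof.
move=> h0; rewrite ler_norml /clamp le_max ge_max ge_min !lexx orbT andbT /=.
by lra.
Qed.

Lemma clamp_id (R : realType) (h x : R) : `|x| <= h -> clamp h x = x.
Proof. by rewrite ler_norml /clamp => /andP[? ?]; rewrite min_l ?max_r. Qed.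

Lemma near_norm_lt (R : realType) (x h : R) : `|x| < h -> \forall y \near x, `|y| < h.
Proof.
move=> xh; apply/nbhs_normP; exists (h - `|x|) => /=; first by rewrite subr_gt0.
move=> y /= xy; rewrite -(subrK x y); apply: le_lt_trans (ler_normD _ _) _.
by rewrite distrC -ltrBrDr.
Qed.

Lemma second_primitive (R : realType) (f : R -> R) : continuous f ->
  exists H : R -> R, [/\ H 0 = 0, derive1 H 0 = 0 &
    forall x, `|x| < 1 ->
      derivable H x 1 /\ is_derive x (1 : R) (derive1 H) (f x)].
Proof.
move=> cf; have [G G0 dG] := primitive cf (ltr0Sn R 1).
(* G is known to be differentiable, hence continuous, on ]-2, 2[ only. *)
have cG : continuous (G \o clamp 1).
  move=> x; apply: continuous_comp; first exact: clamp_continuous.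
  apply/differentiable_continuous/derivable1_diffP.
  have []// := dG (clamp 1 x).
  by apply: le_lt_trans (clamp_norm_le _ ler01) _; rewrite ltr1n.
have [H H0 dH] := primitive cG ltr01.
have dHE x : `|x| < 1 -> derive1 H x = G x.
  move=> x1; rewrite derive1E; case: (dH _ x1) => _ ->.
  by rewrite /= clamp_id// ltW.
exists H; split => //; first by rewrite dHE ?normr0.
move=> x x1; split; first by case: (dH _ x1).
have : is_derive x 1 G (f x) by apply: dG; lra.
apply: near_eq_is_derive.
near=> y; rewrite dHE//; near: y.
exact: near_norm_lt.
Unshelve. all: by end_near. Qed.

Lemma is_derive_rVP (R : realType) n (M : R -> 'rV[R]_n) (t : R) (d : 'rV[R]_n) :
  is_derive t (1 : R) M d <->
  forall i, is_derive t (1 : R) (fun t => M t 0 i) (d 0 i).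
Proof.
split=> [[dM <-] i|dM].
  by split; [exact: (derivable_mxP M t 1).1|rewrite derive_mx// mxE].
have dMt : derivable M t 1.
  by apply/derivable_mxP => i j; rewrite ord1; case: (dM j).
split => //; apply/rowP => i; rewrite derive_mx// mxE; by case: (dM i).
Qed.

Lemma second_primitive_rV (R : realType) n (f : R -> 'rV[R]_n) : continuous f ->
  exists H : R -> 'rV[R]_n, [/\ H 0 = 0, derive1 H 0 = 0 &
    forall x, `|x| < 1 ->
      derivable H x 1 /\ is_derive x (1 : R) (derive1 H) (f x)].
Proof.
move=> cf.
have cfi i : continuous (fun t => f t 0 i).
  move=> t; apply: (@continuous_comp _ _ _ f (fun M : 'rV[R]_n => M 0 i)).
    exact: cf.
  exact: coord_continuous.
have [h hP] := choice (fun i => second_primitive (cfi i)).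
pose H t : 'rV[R]_n := \row_i h i t.
have dH x : `|x| < 1 -> is_derive x (1 : R) H (\row_i derive1 (h i) x).
  move=> x1; apply/is_derive_rVP => i; have [_ _ /(_ x x1)[dhi _]] := hP i.
  rewrite mxE derive1E (_ : (fun t => H t 0 i) = h i); last first.
    by apply/funext => t; rewrite mxE.
  exact/derivableP.
have dHE x : `|x| < 1 -> derive1 H x = \row_i derive1 (h i) x.
  by move=> x1; rewrite derive1E; case: (dH x x1).
exists H; split=> [||x x1].
- by apply/rowP => i; rewrite !mxE; case: (hP i).
- by rewrite dHE ?normr0//; apply/rowP => i; rewrite !mxE; case: (hP i).
- split; first by case: (dH x x1).
  suff : is_derive x (1 : R) (fun x => \row_i derive1 (h i) x) (f x).
    move=> dR; refine (near_eq_is_derive _ dR); near=> y.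
    by rewrite dHE//; near: y; exact: near_norm_lt.
  apply/is_derive_rVP => i; have [_ _ /(_ x x1)[_ dhi]] := hP i.
  rewrite (_ : (fun t => _) = derive1 (h i))//.
  by apply/funext => t; rewrite mxE.
Unshelve. all: by end_near. Qed.

(** Two mean value estimates in succession from zero initial data, coordinate by coordinate. It
    yields both the invariance and the contraction bound of the Picard operator. *)
Lemma second_derivative_bound (R : realType) n (D dd : R -> 'rV[R]_n) (h K : R) :
  D 0 = 0 -> derive1 D 0 = 0 ->
  (forall t, `|t| <= h -> derivable D t 1 /\ is_derive t (1 : R) (derive1 D) (dd t)) ->
  (forall t, `|t| <= h -> `|dd t| <= K) ->
  forall t, `|t| <= h -> `|D t| <= h ^+ 2 * K.
Proof.
move=> D0 D'0 dD ddK t th.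
have h0 : 0 <= h := le_trans (normr_ge0 _) th.
have K0 : 0 <= K by apply: le_trans (ddK 0 _); rewrite ?normr0.
have between (s x : R) : `|s| <= h -> Num.min 0 s <= x <= Num.max 0 s -> `|x| <= h.
  by rewrite !ler_norml; case: (leP 0 s) => _; lra.
have D'K s i : `|s| <= h -> `|derive1 D s 0 i| <= K * h.
  move=> sh; have := @MVT_bound R (fun s => derive1 D s 0 i) (fun s => dd s 0 i) 0 s K.
  rewrite D'0 mxE !subr0 => H; apply: le_trans (H _ _) _.
  - by move=> x /(between _ _ sh)/dD[_ /is_derive_rVP].
  - by move=> x /(between _ _ sh)/ddK; apply: le_trans; exact: ler_coord_norm.
  - by rewrite ler_wpM2l.
apply: rV_norm_le => [|i]; first by rewrite mulr_ge0// sqr_ge0.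
have := @MVT_bound R (fun s => D s 0 i) (fun s => derive1 D s 0 i) 0 t (K * h).
rewrite D0 mxE !subr0 => H; apply: le_trans (H _ _) _.
- move=> x /(between _ _ th)/dD[dDx _].
  have /is_derive_rVP : is_derive x (1 : R) D (derive1 D x); last exact.
  by rewrite derive1E; exact/derivableP.
- by move=> x /(between _ _ th)/D'K.
- apply: le_trans (ler_wpM2l _ th) _; [exact: mulr_ge0|lra].
Qed.

(** Banach's fixed point theorem for the sup distance, which is expressed through uniform bounds [K]
    instead of a metric on a function space. The iterates start at the constant [p] and converge
    uniformly, so the limit is continuous. *)
Lemma uniform_contraction_fixpoint (R : realType) (T : topologicalType)
    (V : completeNormedModType R) (Phi : (T -> V) -> T -> V)
    (Inv : (T -> V) -> Prop) (p : V) (rho : R) :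
  (forall y, Inv y <-> continuous y /\ forall t, `|y t - p| <= rho) ->
  0 <= rho ->
  (forall y, Inv y -> Inv (Phi y)) ->
  (forall y z K, Inv y -> Inv z -> (forall t, `|y t - z t| <= K) ->
    forall t, `|Phi y t - Phi z t| <= K / 2) ->
  exists2 y, Inv y & Phi y = y.
Proof.
move=> InvE rho0 PhiInv Phic.
pose X k := iter k Phi (cst p).
pose b k := rho * 2^-1 ^+ k.
have XInv k : Inv (X k).
  elim: k => [|k IH]; last exact: PhiInv.
  apply/InvE; split=> [|t]; first exact: cst_continuous.
  by rewrite subrr normr0.
have Xstep k t : `|X k.+1 t - X k t| <= b k.
  elim: k t => [|k IH] t.
    by rewrite /b expr0 mulr1; have /InvE[_ /(_ t)] := XInv 1%N.
  rewrite /b exprSr mulrA; exact: (Phic (X k.+1) (X k) _ (XInv _) (XInv _) IH t).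
have b0 k : 0 <= b k by rewrite mulr_ge0// exprn_ge0.
have bS k : b k.+1 = b k / 2 by rewrite /b exprSr mulrA.
(* The right-hand side is the geometric sum of [b] from [k] to [k + m - 1]. *)
have Xcauchy k m t : `|X (k + m)%N t - X k t| <= 2 * b k - 2 * b (k + m)%N.
  elim: m => [|m IH]; first by rewrite addn0 !subrr normr0.
  rewrite addnS bS -(subrKA (X (k + m)%N t)).
  apply: le_trans (ler_normD _ _) _; have := Xstep (k + m)%N t; move: IH; lra.
have bsmall e : 0 < e -> exists k, 2 * b k < e.
  move=> e0; have h1 : `|2^-1 : R| < 1 by rewrite ger0_norm// invf_lt1// ltr1n.
  have /cvgrPdist_lt/(_ _ e0)[k _ kP] := cvg_geometric (2 * rho) h1.
  exists k; have := kP k (leqnn k); rewrite /= sub0r normrN /geometric /b -mulrA.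
  exact: le_lt_trans (ler_norm _).
have Xcvg t : cvg (X ^~ t @ \oo).
  apply/cauchy_cvgP/cauchy_exP => e e0; have [k ke] := bsmall _ e0.
  exists (X k t); exists k => // m /= km; rewrite -ball_normE /= distrC.
  have := Xcauchy k (m - k)%N t; rewrite subnKC// => /le_lt_trans; apply.
  by have := b0 m; lra.
pose Y t : V := lim (X ^~ t @ \oo).
have XY k t : `|Y t - X k t| <= 2 * b k.
  have XkY : `|X m t - X k t| @[m --> \oo] --> `|Y t - X k t|.
    by apply: cvg_norm; apply: cvgB; [exact: Xcvg|exact: cvg_cst].
  apply: (cvgr_to_le XkY); near=> m.
  have := Xcauchy k (m - k)%N t; rewrite subnKC; last by near: m; exists k.
  by move=> /le_trans; apply; have := b0 m; lra.
have YInv : Inv Y.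
  apply/InvE; split=> [t|t].
    apply/cvgrPdist_lt => e e0; have e3 : 0 < e / 3 by lra.
    have [k ke] := bsmall _ e3.
    have /InvE[/(_ t) /cvgrPdist_lt/(_ _ e3) + _] := XInv k.
    apply: filterS => s sP; rewrite -(subrKA (X k t)).
    apply: le_lt_trans (ler_normD _ _) _.
    have := XY k t; rewrite -(subrKA (X k s) (X k t)).
    have := ler_normD (X k t - X k s) (X k s - Y s).
    have := XY k s; rewrite (distrC (Y s)); lra.
  apply/ler_addgt0Pr => e e0; have [k ke] := bsmall _ e0.
  rewrite -(subrKA (X k t)); apply: le_trans (ler_normD _ _) _.
  by have := XY k t; have /InvE[_ /(_ t)] := XInv k; lra.
(* Compare through [X k.+1 = Phi (X k)]: the two errors are at most [b k] and [2 * b k.+1 = b k],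
   hence below [e] together. *)
exists Y => //; apply/funext => t; apply/eqP; rewrite -subr_eq0 -normr_le0.
apply/ler_addgt0Pr => e e0; rewrite add0r; have [k ke] := bsmall _ e0.
rewrite -(subrKA (X k.+1 t)); apply: le_trans (ler_normD _ _) _.
have := XY k.+1 t; have := Phic Y (X k) _ YInv (XInv k) (XY k) t.
rewrite bS (distrC (Y t)); move: ke; have := b0 k; rewrite /=; lra.
Unshelve. all: by end_near. Qed.

(* Makes 'M[R]_(m, n) a completeNormedModType. *)
HB.instance Definition _ (R : realType) (m n : nat) := Complete.on 'M[R]_(m, n).

(** Picard iteration applied directly to the second-order equation: the operator sends [y] to
    [p + t *: w] plus the double primitive of [F \o y] with zero initial data. *)
Lemma local_second_order_solution (R : realType) n (F : 'rV[R]_n -> 'rV[R]_n)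
    (p w : 'rV[R]_n) (rho L : R) :
  0 < rho -> 0 <= L -> continuous F ->
  (forall x y, `|x - p| <= rho -> `|y - p| <= rho ->
    `|F y - F x| <= L * `|y - x|) ->
  exists2 h : R, 0 < h & exists x : R -> 'rV[R]_n,
    [/\ x 0 = p, derive1 x 0 = w & forall t, `|t| < h ->
      derivable x t 1 /\ is_derive t (1 : R) (derive1 x) (F (x t))].
Proof.
move=> rho0 L0 cF FL.
pose M := `|F p| + L * rho.
have M0 : 0 <= M by rewrite addr_ge0// mulr_ge0// ltW.
have FM x : `|x - p| <= rho -> `|F x| <= M.
  move=> xp; rewrite -(subrK (F p) (F x)); apply: le_trans (ler_normD _ _) _.
  rewrite addrC lerD// (le_trans (FL p x _ xp))//; first by rewrite subrr normr0 ltW.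
  by rewrite ler_wpM2l.
(* Each summand secures one smallness condition on [h = C^-1]: [h], [h * L] at most 1/2, and
   [h * |w|], [h * M] at most [rho / 2]. *)
pose C := 2 + 2 * (`|w| / rho) + 2 * (M / rho) + 2 * L.
have A0 : 0 <= `|w| / rho by rewrite divr_ge0// ltW.
have B0 : 0 <= M / rho by rewrite divr_ge0// ltW.
have C0 : 0 < C by rewrite /C; lra.
pose h := C^-1; have h0 : 0 < h by rewrite invr_gt0.
have hle (a : R) : 0 <= a -> 2 * a <= C -> h * a <= 2^-1.
  by move=> a0 aC; rewrite mulrC ler_pdivrMr//; lra.
have h1 : h <= 2^-1 by have := hle 1 ler01; rewrite mulr1 mulr1; apply; rewrite /C; lra.
have hw : h * `|w| <= rho / 2.
  rewrite -(divfK (lt0r_neq0 rho0) `|w|) mulrA mulrC ler_pM2l//.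
  by apply: hle => //; rewrite /C; lra.
have hM : h * M <= rho / 2.
  rewrite -(divfK (lt0r_neq0 rho0) M) mulrA mulrC ler_pM2l//.
  by apply: hle => //; rewrite /C; lra.
have hL : h * L <= 2^-1 by apply: hle => //; rewrite /C; lra.
have h2 (K : R) : 0 <= K -> h ^+ 2 * K <= h * K.
  by move=> K0; rewrite expr2 ler_wpM2r// ler_piMl// ltW//; lra.
(* A double primitive exists for continuous [y] only; choice makes it a total operator, with junk
   value [cst 0] elsewhere. *)
have /choice[Q QP] : forall y : R -> 'rV[R]_n, exists H : R -> 'rV[R]_n, continuous y ->
    [/\ H 0 = 0, derive1 H 0 = 0 & forall t, `|t| < 1 ->
      derivable H t 1 /\ is_derive t (1 : R) (derive1 H) (F (y t))].
  move=> y.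
  have [cy|ncy] := pselect (continuous y); last by exists (cst 0).
  have cFy : continuous (F \o y).
    by move=> t; apply: continuous_comp; [exact: cy|exact: cF].
  by have [H HP] := second_primitive_rV cFy; exists H.
have lt1 (t : R) : `|t| <= h -> `|t| < 1 by move=> th; lra.
pose Psi y t : 'rV[R]_n := p + t *: w + Q y t.
have dPsi y t : continuous y -> `|t| < 1 ->
    is_derive t (1 : R) (Psi y) (w + derive1 (Q y) t).
  move=> /QP[_ _ dQ] t1; have [d1 _] := dQ t t1.
  have dQt : is_derive t (1 : R) (Q y) (derive1 (Q y) t).
    by rewrite derive1E; exact/derivableP.
  have dw : is_derive t (1 : R) (fun t : R => t *: w) w.
    have dw := is_diff_scalel t w.
    by split; [exact/derivable1_diffP|rewrite deriveE// diff_val scale1r].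
  have := is_deriveD (is_deriveD (is_derive_cst p t (1 : R)) dw) dQt.
  by rewrite add0r.
(* Clamping time makes the iterates total and the bounds uniform on R. *)
pose Phi y := Psi y \o clamp h.
pose Inv (y : R -> 'rV[R]_n) := continuous y /\ forall t, `|y t - p| <= rho.
have ch t : `|clamp h t| <= h by rewrite clamp_norm_le// ltW.
have PhiInv y : Inv y -> Inv (Phi y).
  move=> [cy yp]; have [Q0 Q'0 dQ] := QP _ cy; split=> t.
    apply: continuous_comp; first exact: clamp_continuous.
    apply/differentiable_continuous/derivable1_diffP.
    by case: (dPsi _ _ cy (lt1 _ (ch t))).
  rewrite /Phi /Psi /= -(addrA p) (addrC p) addrK; apply: le_trans (ler_normD _ _) _.
  have H1 : `|clamp h t *: w| <= rho / 2.
    by rewrite normrZ (le_trans _ hw)// ler_wpM2r.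
  have H2 : `|Q y (clamp h t)| <= rho / 2.
    apply: le_trans hM; apply: le_trans (h2 _ M0).
    apply: (second_derivative_bound (dd := fun s => F (y s)) Q0 Q'0 _ _ (ch t))
      => [s /lt1/dQ//|s _].
    by apply: FM.
  lra.
have Phic y z K : Inv y -> Inv z -> (forall t, `|y t - z t| <= K) ->
    forall t, `|Phi y t - Phi z t| <= K / 2.
  move=> [cy yp] [cz zp] yz t.
  have [Qy0 Q'y0 dQy] := QP _ cy; have [Qz0 Q'z0 dQz] := QP _ cz.
  have K0 : 0 <= K := le_trans (normr_ge0 _) (yz 0).
  rewrite /Phi /Psi /= opprD addrACA subrr add0r.
  have dB s : `|s| < 1 -> derive1 (Q y - Q z) s = derive1 (Q y) s - derive1 (Q z) s.
    by move=> s1; rewrite !derive1E deriveB//; [case: (dQy s s1)|case: (dQz s s1)].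
  have B : `|(Q y - Q z) (clamp h t)| <= h ^+ 2 * (L * K).
    apply: (second_derivative_bound (dd := fun s => F (y s) - F (z s)) _ _ _ _ (ch t)).
    - by rewrite !fctE /= Qy0 Qz0 subrr.
    - by rewrite dB ?normr0// Q'y0 Q'z0 subrr.
    - move=> s /lt1 s1; have [d1 d2] := dQy s s1; have [d3 d4] := dQz s s1.
      split; first exact: derivableB.
      refine (near_eq_is_derive _ (is_deriveB d2 d4)).
      by near=> u; rewrite dB//; near: u; exact: near_norm_lt.
    - by move=> s _; rewrite (le_trans (FL _ _ _ _))// ler_wpM2l.
  apply: le_trans B _; apply: le_trans (h2 _ (mulr_ge0 L0 K0)) _.
  by rewrite mulrA mulrC ler_wpM2l.
have [//|Y [cY Yp] YE] := uniform_contraction_fixpoint (V := 'rV[R]_n) (p := p)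
  _ (ltW rho0) PhiInv Phic.
have [Q0 Q'0 dQ] := QP _ cY.
(* The fixed point without the clamp: it agrees with [Y] for [|t| < h], where it therefore solves
   the equation. *)
pose x := Psi Y.
have xE t : `|t| < h -> x t = Y t.
  by move=> th; rewrite -[in RHS]YE /Phi /= clamp_id// ltW.
have dxE t : `|t| < 1 -> derive1 x t = w + derive1 (Q Y) t.
  by move=> t1; rewrite derive1E; case: (dPsi _ _ cY t1).
exists h => //; exists x; split.
- by rewrite /x /Psi scale0r addr0 Q0 addr0.
- by rewrite dxE ?normr0// Q'0 addr0.
- move=> t th; have t1 := lt1 _ (ltW th); split; first by case: (dPsi _ _ cY t1).
  have [_ d2] := dQ t t1; rewrite xE//.
  have := is_deriveD (is_derive_cst w t (1 : R)) d2; rewrite add0r => d3.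
  refine (near_eq_is_derive _ d3).
  by near=> u; rewrite dxE//; near: u; exact: near_norm_lt.
Unshelve. all: by end_near. Qed.

(** * Local and maximal solutions of Newton's equation *)

Lemma grad_continuous (R : realType) n (U : 'rV[R]_n -> R) :
  is_Ck 1 U -> continuous (grad U).
Proof.
move=> [_ UC] x; apply/(@cvgrPdist_le _ _ _ (nbhs x) (nbhs_filter x)) => e e0.
have H : \forall y \near x, forall i, `|partial i U x - partial i U y| <= e.
  apply: (@filter_forall _ _ (fun i y => `|partial i U x - partial i U y| <= e)
    _ (nbhs_filter x)) => i.
  by have [_ [ci _]] := UC i; move/cvgrPdist_le: (ci x) => /(_ _ e0).
near=> y; apply: rV_norm_le => [|i]; first exact: ltW.
by rewrite !mxE; move: i; near: y; exact: H.
Unshelve. all: by end_near. Qed.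

Lemma grad_locally_lipschitz (R : realType) n (U : 'rV[R]_n -> R) (p : 'rV[R]_n) :
  is_Ck 2 U ->
  exists rho L : R, [/\ 0 < rho, 0 <= L & forall x y,
    `|x - p| <= rho -> `|y - p| <= rho -> `|grad U y - grad U x| <= L * `|y - x|].
Proof.
move=> [_ UC].
have H i := C1_locally_lipschitz p (UC i).2.
have /choice[L LP] : forall i, exists L : R, 0 <= L /\ \forall r \near 0^'+, forall x y,
    `|x - p| <= r -> `|y - p| <= r ->
    `|partial i U y - partial i U x| <= L * `|y - x|.
  by move=> i; have [L L0 LP] := H i; exists L.
have : \forall r \near 0^'+, 0 < r /\ forall i x y, `|x - p| <= r -> `|y - p| <= r ->
    `|partial i U y - partial i U x| <= L i * `|y - x|.
  near=> r; split; first by near: r; exact: nbhs_right_gt.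
  near: r; apply: (@filter_forall _ _ (fun i r => forall x y,
    `|x - p| <= r -> `|y - p| <= r ->
    `|partial i U y - partial i U x| <= L i * `|y - x|) _ _) => i.
  by case: (LP i).
move=> /filter_ex[rho [rho0 rhoP]].
exists rho, (\sum_i L i); split => // [|x y xp yp].
  by apply: sumr_ge0 => i _; case: (LP i).
apply: rV_norm_le => [|i].
  by rewrite mulr_ge0// sumr_ge0// => i _; case: (LP i).
rewrite !mxE; apply: le_trans (rhoP i x y xp yp) _; rewrite ler_wpM2r//.
by rewrite (bigD1 i)//= lerDl sumr_ge0// => j _; case: (LP j).
Unshelve. all: by end_near. Qed.

Lemma newton_local_solution (R : realType) n (U : 'rV[R]_n -> R) (p w : 'rV[R]_n) :
  is_Ck 2 U ->
  exists J x, newton_solution U J x /\ phase x 0 = (p, w).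
Proof.
move=> UC; have [rho [L [rho0 L0 UL]]] := grad_locally_lipschitz p UC.
have UC1 := is_CkS UC.
have cF : continuous (fun x => - grad U x).
  by move=> x; apply: continuousN; exact: grad_continuous.
have FL x y : `|x - p| <= rho -> `|y - p| <= rho ->
    `|- grad U y - - grad U x| <= L * `|y - x|.
  by move=> xp yp; rewrite -opprD normrN; exact: UL.
have [h h0 [x [x0 x'0 dx]]] := local_second_order_solution w rho0 L0 cF FL.
exists `](- h), h[%classic, x; split; last by rewrite /phase x0 x'0.
split.
- exact: interval_open.
- exact: interval_is_interval.
- by rewrite /= in_itv /=; lra.
- by move=> t /=; rewrite in_itv /= -ltr_norml; exact: dx.
Qed.

Lemma derive_of_eq_on_open (R : realType) (V : normedModType R) (J : set R)
    (x y : R -> V) (t : R) :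
  open J -> J t -> (forall s, J s -> y s = x s) ->
  [/\ derivable x t 1 -> derivable y t 1, derive1 y t = derive1 x t &
   forall d, is_derive t (1 : R) (derive1 x) d -> is_derive t (1 : R) (derive1 y) d].
Proof.
move=> oJ Jt yx.
have near_eq s : J s -> \forall u \near s, x u = y u.
  by move=> Js; near=> u; apply/esym/yx; near: u; exact: open_nbhs_nbhs.
have deq s : J s -> derive1 y s = derive1 x s.
  by move=> Js; rewrite !derive1E; apply/esym/near_eq_derive/near_eq.
split; [exact/near_eq_derivable/near_eq|exact: deq|move=> d dx].
refine (near_eq_is_derive _ dx); near=> u; apply/esym/deq; near: u.
exact: open_nbhs_nbhs.
Unshelve. all: by end_near. Qed.

(** Zorn's lemma on the solutions extending the given one. Extension is only a preorder, since total
    functions may differ outside their interval. *)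
Lemma maximal_extension (R : realType) n (U : 'rV[R]_n -> R) J0 x0 :
  newton_solution U J0 x0 ->
  exists J x, maximal_newton_solution U J x /\ phase x 0 = phase x0 0.
Proof.
move=> s0.
pose ext (s s' : set R * (R -> 'rV[R]_n)) :=
  s.1 `<=` s'.1 /\ forall t, s.1 t -> s'.2 t = s.2 t.
have ext_trans a b c : ext a b -> ext b c -> ext a c.
  move=> [ab1 ab2] [bc1 bc2]; split; first exact: subset_trans bc1.
  by move=> t at_; rewrite bc2 ?ab2//; exact: ab1.
pose T := {s | newton_solution U s.1 s.2 /\ ext (J0, x0) s}.
have t0 : T by exists (J0, x0); split => //; split.
have [||A Atot|[[J x] [/= sol ext0]] xmax] :=
  @ZL_preorder T t0 (fun s s' => `[< ext (sval s) (sval s') >]).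
- by move=> s; apply/asboolP; split.
- by move=> a b c /asboolP ab /asboolP bc; apply/asboolP; exact: ext_trans bc.
(* An empty union would not contain 0, so the empty chain is bounded by the given solution
   instead. *)
- have [A0|/set0P[a0 Aa0]] := eqVneq A set0.
    by exists t0 => s; rewrite A0.
  have {}Atot a b : A a -> A b -> ext (sval a) (sval b) \/ ext (sval b) (sval a).
    by move=> Aa Ab; have [/asboolP|/asboolP] := Atot a b Aa Ab; [left|right].
  pose J := \bigcup_(a in A) (sval a).1.
  (* Members of a chain agree on overlaps, so they glue to one function on the union. *)
  have /choice[x xP] : forall t, exists v, forall a, A a ->
      (sval a).1 t -> v = (sval a).2 t.
    move=> t; have [[a Aa at_]|nJ] := pselect (J t); last first.
      by exists 0 => a Aa at_; exfalso; apply: nJ; exists a.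
    exists ((sval a).2 t) => b Ab bt.
    by have [[_ ->]|[_ ->]] := Atot _ _ Aa Ab.
  have solA (a : T) : newton_solution U (sval a).1 (sval a).2.
    exact: (proj1 (proj2_sig a)).
  have sol : newton_solution U J x.
    split.
    - by apply: bigcup_open => a _; case: (solA a).
    - move=> s t [a Aa as_] [b Ab bt] u sut.
      have [c [Ac cs ct]] : exists c, [/\ A c, (sval c).1 s & (sval c).1 t].
        have [[ab _]|[ba _]] := Atot _ _ Aa Ab; first by exists b; split => //; exact: ab.
        by exists a; split => //; exact: ba.
      by exists c => //; have [_ ci _ _] := solA c; exact: (ci s t).
    - by exists a0 => //; case: (solA a0).
    - move=> t [a Aa at_]; have [ao _ _ /(_ t at_)[da dda]] := solA a.
      have [d1 _ d2] := derive_of_eq_on_open ao at_ (fun s => xP s a Aa).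
      by split; [exact: d1|rewrite (xP t a Aa at_); exact: d2].
  have exta a : A a -> ext (sval a) (J, x).
    by move=> Aa; split=> [t at_|t at_]; [exists a|exact: xP].
  have ext0 : ext (J0, x0) (J, x).
    exact: ext_trans (proj2 (proj2_sig a0)) (exta _ Aa0).
  exists (exist _ (J, x) (conj sol ext0)) => a Aa; apply/asboolP; exact: exta.
exists J, x; split.
  split=> // J' y soly JJ' yx.
  have exty : ext (J, x) (J', y) by split.
  have := xmax (exist _ (J', y) (conj soly (ext_trans _ _ _ ext0 exty))).
  move=> /(_ (asboolT exty))/asboolP[/= J'J _].
  by apply/seteqP.
have [J0o _ J00 _] := s0; have [_ dE _] := derive_of_eq_on_open J0o J00 ext0.2.
by have [_ /= xE] := ext0; rewrite /phase dE xE.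
Qed.

(** * Escape along the Euler field *)

(** Euler's identity: differentiate the quasi-homogeneity relation in [lambda] at 1. *)
Lemma quasi_homogeneous_euler (R : realType) n (U : 'rV[R]_n -> R)
    (alpha : 'rV[R]_n) (r : R) (x : 'rV[R]_n) :
  is_Ck 1 U ->
  (forall lambda : R, 0 < lambda -> forall x : 'rV[R]_n,
    U (\row_i (lambda `^ alpha 0 i * x 0 i)) = lambda `^ r * U x) ->
  \sum_i partial i U x * (alpha 0 i * x 0 i) = r * U x.
Proof.
move=> UC Uqh.
pose c (lambda : R) : 'rV[R]_n := \row_i (lambda `^ alpha 0 i * x 0 i).
have dpow (a : R) : is_derive (1 : R) (1 : R) (fun l => l `^ a) a.
  by have := is_derive1_powR a (@ltr01 R); rewrite powR1 mulr1.
have c1 : c 1 = x by apply/rowP => i; rewrite mxE powR1 mul1r.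
have dc : is_derive (1 : R) (1 : R) c (\row_i (alpha 0 i * x 0 i)).
  apply/is_derive_rVP => i; rewrite mxE.
  rewrite (_ : (fun t => _) = (fun l => l `^ alpha 0 i * x 0 i)); last first.
    by apply/funext => l; rewrite mxE.
  have := is_deriveM (dpow (alpha 0 i)) (is_derive_cst (x 0 i) (1 : R) (1 : R)).
  by rewrite scaler0 add0r [_ *: _]mulrC.
have dcv : derivable c 1 1 by case: dc.
have := C1_chain_rule UC dcv.
rewrite c1 (_ : derive1 c 1 = \row_i (alpha 0 i * x 0 i)); last first.
  by rewrite derive1E; case: dc.
move=> [_ dUc].
have -> : \sum_i partial i U x * (alpha 0 i * x 0 i) =
    \sum_i partial i U x * (\row_i (alpha 0 i * x 0 i)) 0 i.
  by apply: eq_bigr => i _; rewrite mxE.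
rewrite -dUc.
(* The relation holds only for positive [l], which is a neighborhood of 1. *)
have -> : 'D_1 (U \o c) 1 = 'D_1 (fun l => l `^ r * U x) 1.
  apply: near_eq_derive; near=> l; rewrite /= Uqh//.
  by near: l; exact: lt_nbhsr.
have := is_deriveM (dpow r) (is_derive_cst (U x) (1 : R) (1 : R)).
by rewrite scaler0 add0r => -[_ ->]; rewrite [LHS]mulrC.
Unshelve. all: by end_near. Qed.

(** * Energy, weighted square and virial along a solution *)

Lemma is_derive_fsum (R : realType) n (h : 'I_n -> R -> R) (dh : 'I_n -> R) (t : R) :
  (forall i, is_derive t (1 : R) (h i) (dh i)) ->
  is_derive t (1 : R) (fun t => \sum_i h i t) (\sum_i dh i).
Proof.
move=> dhP; have := is_derive_sum dhP.
by rewrite (_ : \sum_i h i = fun t => \sum_i h i t)//;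
   apply/funext => s; rewrite fct_sumE.
Qed.

Section along_solutions.
Variables (R : realType) (n : nat) (U : 'rV[R]_n -> R) (alpha : 'rV[R]_n).
Variables (J : set R) (x : R -> 'rV[R]_n).
Hypotheses (U_C1 : is_Ck 1 U) (xsol : newton_solution U J x).

Definition energy (z : 'rV[R]_n * 'rV[R]_n) : R :=
  \sum_i z.2 0 i ^+ 2 / 2 + U z.1.

(** The function G whose gradient is the Euler field; the weights may have any sign. *)
Definition weighted_square (z : 'rV[R]_n) : R := \sum_i alpha 0 i * z 0 i ^+ 2 / 2.

(** The pairing of the Euler field with the velocity, which is G' along a solution. *)
Definition virial (z : 'rV[R]_n * 'rV[R]_n) : R :=
  \sum_i alpha 0 i * (z.1 0 i * z.2 0 i).

Lemma position_derive t i : J t ->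
  is_derive t (1 : R) (fun t => x t 0 i) (derive1 x t 0 i).
Proof.
move=> Jt; have [_ _ _ /(_ t Jt)[dx _]] := xsol.
have /is_derive_rVP : is_derive t (1 : R) x (derive1 x t); last exact.
by rewrite derive1E; exact/derivableP.
Qed.

Lemma velocity_derive t i : J t ->
  is_derive t (1 : R) (fun t => derive1 x t 0 i) (- partial i U (x t)).
Proof.
move=> Jt; have [_ _ _ /(_ t Jt)[_ /is_derive_rVP/(_ i)]] := xsol.
by rewrite !mxE.
Qed.

Lemma energy_derive t : J t -> is_derive t (1 : R) (fun t => energy (phase x t)) 0.
Proof.
move=> Jt.
have dx : derivable x t 1 by have [_ _ _ /(_ t Jt)[]] := xsol.
have dK : is_derive t (1 : R) (fun t => \sum_i derive1 x t 0 i ^+ 2 / 2)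
    (\sum_i derive1 x t 0 i * - partial i U (x t)).
  apply: is_derive_fsum => i; have dv := velocity_derive i Jt.
  apply: is_derive_eq; rewrite /GRing.scale/=; lra.
have := is_deriveD dK (C1_chain_rule U_C1 dx).
rewrite -big_split big1 => [//|i _ /=]; ring.
Qed.

Lemma weighted_square_derive t : J t ->
  is_derive t (1 : R) (fun t => weighted_square (x t)) (virial (phase x t)).
Proof.
move=> Jt; apply: is_derive_fsum => i; have dxi := position_derive i Jt.
apply: is_derive_eq; rewrite /GRing.scale/=; lra.
Qed.

Lemma virial_derive t : J t ->
  is_derive t (1 : R) (fun t => virial (phase x t))
    (\sum_i alpha 0 i * derive1 x t 0 i ^+ 2
      - \sum_i partial i U (x t) * (alpha 0 i * x t 0 i)).
Proof.
move=> Jt; rewrite -sumrB; apply: is_derive_fsum => i.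
have dxi := position_derive i Jt; have dvi := velocity_derive i Jt.
apply: is_derive_eq; rewrite /GRing.scale/=; ring.
Qed.

End along_solutions.

(** * Equilibrium and instability *)

Lemma grad_eq0_of_min (R : realType) n (U : 'rV[R]_n -> R) (p : 'rV[R]_n) :
  (forall i x, derivable U x 'e_i) -> (forall x, U p <= U x) -> grad U p = 0.
Proof.
move=> dU minU; apply/rowP => i; rewrite !mxE.
have dg s := is_derive_line (dU i (p + s *: 'e_i)).
have [_ <-] : is_derive (0 : R) (1 : R) (fun s => U (p + s *: 'e_i)) 0.
  apply: (@derive1_at_min R _ (-1) 1).
  - lra.
  - by move=> s _; case: (dg s).
  - by rewrite in_itv /=; lra.
  - by move=> s _; rewrite scale0r addr0.
by case: (dg 0) => _ ->; rewrite scale0r addr0.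
Qed.

Lemma equilibrium_of_grad_eq0 (R : realType) n (U : 'rV[R]_n -> R) (p : 'rV[R]_n) :
  grad U p = 0 -> equilibrium U (p, 0).
Proof.
move=> gp; have d0 : derive1 (cst p : R -> 'rV[R]_n) = cst 0.
  by apply/funext => t; rewrite derive1_cst.
exists (cst p) => [|t]; last by rewrite /phase d0.
split => //; [exact: openT|move=> t _; split; first exact: derivable_cst].
by rewrite d0 /= gp oppr0; exact: is_derive_cst.
Qed.

(** Existence for all [t >= 0] is a hypothesis because the stability to be refuted supplies it. *)
Lemma weighted_square_escape (R : realType) n (U : 'rV[R]_n -> R)
    (alpha : 'rV[R]_n) (r : R)
    (J : set R) (x : R -> 'rV[R]_n) (p X : 'rV[R]_n) (e S C : R) :
  is_Ck 1 U -> (forall x, 0 <= U x) ->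
  (forall x, \sum_i partial i U x * (alpha 0 i * x 0 i) = r * U x) ->
  newton_solution U J x -> (forall t, 0 <= t -> J t) ->
  U p = 0 -> X = \row_i (alpha 0 i * p 0 i) ->
  S = \sum_i X 0 i ^+ 2 -> C = (\sum_i `|alpha 0 i| + `|r|) * S + 1 ->
  0 < S -> 0 < e -> phase x 0 = (p, e *: X) ->
  exists2 t, 0 <= t &
    weighted_square alpha p + S ^+ 2 / (4 * C) <= weighted_square alpha (x t).
Proof.
move=> UC U0 Ueuler xsol Jge0 Up XE SE CE S0 e0 x0.
have [x0p x'0] : x 0 = p /\ derive1 x 0 = e *: X by case: x0.
have C0 : 0 < C.
  by rewrite CE ltr_wpDl// mulr_ge0 ?addr_ge0 ?sumr_ge0// ltW.
(* The energy has derivative 0, and initially it is purely kinetic because [U p = 0]. *)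
have energyE t : 0 <= t -> energy U (phase x t) = e ^+ 2 * S / 2.
  move=> t0; have := @MVT_bound R (fun t => energy U (phase x t)) (fun=> 0) 0 t 0.
  rewrite mul0r => H; have /eqP : `|energy U (phase x t) - energy U (phase x 0)| = 0.
    apply/le_anti; rewrite normr_ge0 andbT; apply: H => s; last by rewrite normr0.
    by rewrite min_l// => /andP[s0 _]; apply: (energy_derive UC xsol); exact: Jge0.
  rewrite normr_eq0 subr_eq0 => /eqP ->.
  rewrite x0 /energy /= Up addr0 SE mulr_sumr mulr_suml.
  by apply: eq_bigr => i _; rewrite !mxE exprMn.
have speed t i : 0 <= t -> derive1 x t 0 i ^+ 2 <= e ^+ 2 * S.
  move=> /energyE; rewrite /energy /= (bigD1 i)//=.
  have : 0 <= \sum_(j < n | j != i) derive1 x t 0 j ^+ 2 / 2.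
    by apply: sumr_ge0 => j _; rewrite divr_ge0// sqr_ge0.
  by have := U0 (x t); lra.
have height t : 0 <= t -> U (x t) <= e ^+ 2 * S.
  move=> /energyE; rewrite /energy /=.
  have : 0 <= \sum_(j < n) derive1 x t 0 j ^+ 2 / 2.
    by apply: sumr_ge0 => j _; rewrite divr_ge0// sqr_ge0.
  have : 0 <= e ^+ 2 * S by rewrite mulr_ge0 ?sqr_ge0// ltW.
  by lra.
have virial0 : virial alpha (phase x 0) = e * S.
  rewrite x0 /virial SE mulr_sumr; apply: eq_bigr => i _ /=.
  by rewrite XE !mxE; ring.
(* By Euler's identity G'' involves only squared velocities and [r * U], both controlled by the
   energy, whence [|G''| <= e ^+ 2 * C]. *)
have virial_bound t : 0 <= t ->
    `|virial alpha (phase x t) - e * S| <= e ^+ 2 * C * t.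
  move=> t0; rewrite -virial0 -[t in leRHS]subr0 -[t - 0](ger0_norm _) ?subr0//.
  have := @MVT_bound R (fun t => virial alpha (phase x t))
    (fun t => \sum_i alpha 0 i * derive1 x t 0 i ^+ 2 - r * U (x t)) 0 t (e ^+ 2 * C).
  rewrite subr0; apply => s; rewrite min_l// => /andP[s0 _].
    by rewrite -Ueuler; apply: (virial_derive _ xsol); exact: Jge0.
  apply: le_trans (ler_normB _ _) _; rewrite CE.
  have H1 : `|\sum_i alpha 0 i * derive1 x s 0 i ^+ 2| <=
      (\sum_i `|alpha 0 i|) * (e ^+ 2 * S).
    apply: le_trans (ler_norm_sum _ _ _) _; rewrite mulr_suml.
    apply: ler_sum => i _; rewrite normrM ler_wpM2l// ger0_norm ?sqr_ge0//.
    exact: speed.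
  have H2 : `|r * U (x s)| <= `|r| * (e ^+ 2 * S).
    by rewrite normrM ler_wpM2l// ger0_norm// height.
  apply: le_trans (lerD H1 H2) _.
  by have := sqr_ge0 e; lra.
(* The time at which the bound [e ^+ 2 * C * T] on the change of G' reaches half of its initial
   value [e * S]. *)
pose T := S / (2 * C * e).
have T0 : 0 <= T by rewrite divr_ge0 ?mulr_ge0// ltW.
have TE : e * C * T = S / 2 by rewrite /T; field; rewrite !lt0r_neq0.
exists T => //.
(* Removing the linear growth [e * S * t] leaves a derivative of size at most [e * S / 2], so G
   gains at least [e * S * T / 2], in which [e] cancels. *)
have := @MVT_bound R (fun t => weighted_square alpha (x t) - e * S * t)
  (fun t => virial alpha (phase x t) - e * S) 0 T (e * S / 2).
rewrite mulr0 !subr0 x0p (ger0_norm T0) => H.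
have : `|weighted_square alpha (x T) - e * S * T - weighted_square alpha p| <=
    e * S / 2 * T.
  apply: H => t; rewrite min_l// max_r// => /andP[t0 tT].
    have dG := weighted_square_derive alpha xsol (Jge0 _ t0).
    by apply: is_derive_eq; rewrite /GRing.scale/=; lra.
  apply: le_trans (virial_bound t t0) _.
  have -> : e * S / 2 = e ^+ 2 * C * T by rewrite -mulrA -TE; ring.
  by rewrite ler_wpM2l// mulr_ge0 ?sqr_ge0// ltW.
have -> : S ^+ 2 / (4 * C) = e * S * T / 2.
  by rewrite /T; field; rewrite !lt0r_neq0.
by rewrite ler_norml => /andP[+ _]; lra.
Qed.

Lemma weighted_square_continuous (R : realType) n (alpha : 'rV[R]_n) :
  continuous (weighted_square alpha).
Proof.
apply: continuous_fsum => i z.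
apply: (@continuous_comp _ _ _ (fun z : 'rV[R]_n => z 0 i)
  (fun u : R => alpha 0 i * u ^+ 2 / 2)); first exact: coord_continuous.
apply/differentiable_continuous/derivable1_diffP.
exact: ex_derive.
Qed.

Unset Implicit Arguments.

Theorem corollary2 (R : realType) (n : nat) (U : 'rV[R]_n -> R)
    (alpha : 'rV[R]_n)
    (U_ge0 : forall x, 0 <= U x)
    (U_C2 : is_Ck 2 U)
    (U_qh : quasi_homogeneous alpha U) :
  forall z : 'rV[R]_n * 'rV[R]_n,
    ((U @^-1` [set 0] `&` V_ alpha) `*` [set 0]) z ->
    equilibrium U z /\ lyapunov_unstable U z.
Proof.
have UC1 := is_CkS U_C2.
move=> [p _] [[/= Up [i Xi0]] ->]; split.
  apply/equilibrium_of_grad_eq0/grad_eq0_of_min; first by move=> j; case: (UC1.2 j).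
  by move=> x; rewrite Up.
have [r Uqh] := U_qh.
have Ueuler x := quasi_homogeneous_euler x UC1 Uqh.
pose X : 'rV[R]_n := \row_i (alpha 0 i * p 0 i).
pose S := \sum_i X 0 i ^+ 2.
(* Membership of [p] in [V_ alpha] says exactly that the Euler field does not vanish at [p]. *)
have S0 : 0 < S.
  rewrite /S (bigD1 i)//= ltr_wpDr ?sumr_ge0 ?mxE// => [j _|]; first exact: sqr_ge0.
  by rewrite exprn_even_gt0.
pose C := (\sum_i `|alpha 0 i| + `|r|) * S + 1.
have C0 : 0 < C by rewrite ltr_wpDl// mulr_ge0 ?(ltW S0)// addr_ge0 ?sumr_ge0.
pose level := weighted_square alpha p + S ^+ 2 / (4 * C).
have lt_level : weighted_square alpha p < level.
  by rewrite ltrDl divr_gt0 ?exprn_gt0 ?mulr_gt0.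
move=> stable.
(* The neighborhood to escape from is a sublevel set of G, with no constraint on the velocity. *)
have [|O' /nbhs_ballP[d /= d0 dO'] trapped] :=
    stable [set z | weighted_square alpha z.1 < level].
  have cG : {for (p, 0 : 'rV[R]_n), continuous (weighted_square alpha \o fst)}.
    by apply: continuous_comp; [exact: cvg_fst|exact: weighted_square_continuous].
  exact: (cvgr_lt _ cG _ lt_level).
(* Makes [|e *: X| < d], so the initial phase lies in [O']; the [+ 1] keeps the denominator
   positive. *)
pose e := d / (2 * (`|X| + 1)).
have X1 : 0 < `|X| + 1 by rewrite ltr_wpDl.
have e0 : 0 < e by rewrite divr_gt0// mulr_gt0.
have [J0 [x0 [sol0 x0E]]] := newton_local_solution p (e *: X) U_C2.
have [J [x [xmax xE]]] := maximal_extension sol0.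
rewrite x0E in xE.
have := trapped J x xmax; rewrite xE => /(_ (dO' _ _)) H.
have {}H t : 0 <= t -> J t /\ weighted_square alpha (x t) < level.
  apply: H; split => /=; first exact: ballxx.
  rewrite -ball_normE /= sub0r normrN normrZ gtr0_norm// /e.
  by rewrite mulrAC ltr_pdivrMr ?mulr_gt0// ltr_pM2l//; have := normr_ge0 X; lra.
have [t t0] := weighted_square_escape UC1 U_ge0 Ueuler xmax.1 (fun t t0 => (H t t0).1) Up
  (erefl X) (erefl S) (erefl C) S0 e0 xE.
by have [_] := H t t0; rewrite ltNge => /negP.
Qed.
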